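(* Let $A$ be a set and $f\colon A\rightarrow\wp A$ a function. Consider pairs $(B,\prec)$ where $B\subseteq A$ and $\prec$ is a well-ordering of $B$ satisfying $$(\ast)\quad \forall b\in B:\ f(b)=\{x\in B\mid x\prec b\}.$$ Order such pairs by $(B,\prec)\sqsubseteq(B',\prec')$ iff $(B,\prec)$ is an initial segment of, or equal to, $(B',\prec')$ (i.e. $B\subseteq B'$, $\prec'$ restricted to $B$ is $\prec$, and whenever $b'\in B'$, $b\in B$ and $b'\prec' b$ then $b'\in B$). If $(B,\prec)$ is a $\sqsubseteq$-maximal such pair satisfying $(\ast)$, then $B$ is not in the range of $f$, i.e. there is no $a\in A$ with $f(a)=B$.
   Context: $\wp A$ denotes the powerset of $A$. *)

(* Defs.v *)
From mathcomp Require Import all_boot.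
From mathcomp Require Import boolp classical_sets.

Set Implicit Arguments.
Unset Strict Implicit.
Unset Printing Implicit Defensive.

Local Open Scope classical_set_scope.

(* [lt] is carried by the whole type [A]; [well_ordering_on] below forces it to
   be contained in [dom * dom], so that Leibniz equality of such pairs is
   equality of subsets together with equality of relations on them. *)
Record rel_pair (A : Type) := RelPair {
  dom : set A;
  lt : A -> A -> Prop
}.

Record well_ordering_on (A : Type) (B : set A) (R : A -> A -> Prop) : Prop := {
  wo_field : forall x y, R x y -> B x /\ B y;
  wo_irrefl : forall x, B x -> ~ R x x;
  wo_trans : forall x y z, B x -> B y -> B z -> R x y -> R y z -> R x z;
  wo_total : forall x y, B x -> B y -> [\/ R x y, x = y | R y x];
  wo_least : forall X : set A, X `<=` B -> X !=set0 ->
    exists2 m, X m & forall x, X x -> m = x \/ R m x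
}.

Definition star (A : Type) (f : A -> set A) (P : rel_pair A) : Prop :=
  forall b, dom P b -> f b = [set x | dom P x /\ lt P x b].

Definition admissible (A : Type) (f : A -> set A) (P : rel_pair A) : Prop :=
  well_ordering_on (dom P) (lt P) /\ star f P.

Definition initial_le (A : Type) (P Q : rel_pair A) : Prop :=
  [/\ dom P `<=` dom Q,
      forall x y, dom P x -> dom P y -> (lt Q x y <-> lt P x y)
    & forall b' b, dom Q b' -> dom P b -> lt Q b' b -> dom P b'].

Definition maximal_admissible (A : Type) (f : A -> set A) (P : rel_pair A)
  : Prop :=
  admissible f P /\
  forall Q, admissible f Q -> initial_le P Q -> Q = P.

(* Main.v *)
Require Import Defs.
From mathcomp Require Import all_boot.
From mathcomp Require Import boolp classical_sets.

(** Suppose [f a = B].  If [a] lies in [B], the condition [star] at [a] puts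
    [a] in its own initial segment, against irreflexivity.  Otherwise adding
    [a] on top of [B] gives an admissible pair, because the initial segment
    below [a] is exactly [B = f a]; this contradicts maximality. *)

Local Open Scope classical_set_scope.

(** The guard [dom P x] keeps the relation inside the new domain, as [wo_field] requires, and keeps
    a new [a] from lying below itself. *)
Definition add_top {A : Type} (P : rel_pair A) (a : A) : rel_pair A :=
  RelPair (dom P `|` [set a]) (fun x y => lt P x y \/ dom P x /\ y = a).

Lemma add_top_well_ordering (A : Type) (P : rel_pair A) (a : A) :
  ~ dom P a -> well_ordering_on (dom P) (lt P) ->
  well_ordering_on (dom (add_top P a)) (lt (add_top P a)).
Proof.
move=> aP [field irr tr tot least]; split => /=.
- move=> x y [/field[xP yP]|[xP ->]]; first by split; left.
  by split; [left | right].
- by move=> x _ [xx|[xP xa]]; [case: (field _ _ xx) => /irr | rewrite xa in xP].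
- move=> x y z _ _ _ [xy|[xP ya]] [yz|[yP za]].
  + have [[xP yP] [_ zP]] := (field _ _ xy, field _ _ yz).
    by left; apply: tr xy yz.
  + by right; split=> //; case: (field _ _ xy).
  + by case: (field _ _ yz) => yP; rewrite ya in yP.
  + by rewrite ya in yP.
- move=> x y [xP|->] [yP|->].
  + by case: (tot x y xP yP) => h;
      [apply: Or31; left | apply: Or32 | apply: Or33; left].
  + by apply: Or31; right.
  + by apply: Or33; right.
  + exact: Or32.
- move=> X XP [x0 Xx0].
  (* A minimum of the old part of [X] also lies below [a], so it serves for all of [X]; if the old
     part is empty, [X] can only be the singleton of [a]. *)
  have [XP0|XP0] := pselect ((X `&` dom P) !=set0).
    have [m [Xm mP] mmin] := least _ (@subIsetr _ X (dom P)) XP0.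
    exists m => // x Xx; case: (XP _ Xx) => [xP|->]; last by right; right.
    by case: (mmin x (conj Xx xP)); [left | right; left].
  have Xa x : X x -> x = a.
    by move=> Xx; case: (XP _ Xx) => // xP; case: XP0; exists x.
  exists a => [|x /Xa ->]; last by left.
  by rewrite -(Xa _ Xx0).
Qed.

Lemma add_top_star (A : Type) (f : A -> set A) (P : rel_pair A) (a : A) :
  ~ dom P a -> well_ordering_on (dom P) (lt P) -> star f P -> f a = dom P ->
  star f (add_top P a).
Proof.
move=> aP wo fP fa b /= [bP|->]; last first.
  rewrite fa; apply/seteqP; split => x /=; first by move=> xP; split; [left|right].
  by case=> _ [/(wo_field wo)[]|[]].
rewrite fP//; apply/seteqP; split => x /=.
  by case=> xP xb; split; left.
case=> _ [xb|[_ ba]]; last by rewrite ba in bP.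
by split=> //; case: (wo_field wo xb).
Qed.

(** Every added comparison has [a] as its upper term, so nothing changes below an element of
    [dom P]. *)
Lemma initial_le_add_top (A : Type) (P : rel_pair A) (a : A) :
  ~ dom P a -> well_ordering_on (dom P) (lt P) -> initial_le P (add_top P a).
Proof.
move=> aP wo; split => /=.
- by move=> x xP; left.
- move=> x y xP yP; split; last by left.
  by case=> // -[_ ya]; rewrite ya in yP.
- by move=> x y _ yP [/(wo_field wo)[]|[]].
Qed.

Theorem mainTheorem2 (A : Type) (f : A -> set A) (B : set A)
  (prec : A -> A -> Prop)
  (hmax : maximal_admissible f (RelPair B prec)) :
  ~ (exists a : A, f a = B).
Proof.
case: hmax => -[wo fP] Pmax [a fa].
have [aB|aB] := pselect (B a).
  have : f a a by rewrite fa.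
  by rewrite (fP a aB) => -[_ /(wo_irrefl wo aB)].
have topE : add_top (RelPair B prec) a = RelPair B prec.
  apply: Pmax; last exact: initial_le_add_top.
  by split; [exact: add_top_well_ordering | exact: add_top_star].
(* Maximality yields equality of the pairs, hence of their domains, which forces [a] into [B]. *)
have : dom (add_top (RelPair B prec) a) a by right.
by rewrite topE.
Qed.
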